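(* Let $G=(V,E)$ be a connected graph with vertices ordered $v_1,\dots,v_n$ and edge-labeling $\alpha:E\to\{\text{ideals of }\mathbb{Z}/m\mathbb{Z}\}$, where $m=p_1^{e_1}\cdots p_t^{e_t}$ is the primary decomposition of $m$. Let $\mathbb{B}_m$ be the set of splines produced by the following procedure: for each $i$ take the set $\mathbb{B}_{p_i^{e_i}}$ (described in the context) for $[\mathbb{Z}/p_i^{e_i}\mathbb{Z}]_{G,\alpha_{e_i}}$; then repeatedly select one element from each $\mathbb{B}_{p_i^{e_i}}$ (using the zero spline for a given $i$ once all elements of $\mathbb{B}_{p_i^{e_i}}$ have been selected), and take the unique spline in $[\mathbb{Z}/m\mathbb{Z}]_{G,\alpha}$ that projects under $\rho^*$ to the selected tuple; continue until every element of every $\mathbb{B}_{p_i^{e_i}}$ has been used exactly once. Then: (1) for arbitrary choices of the selection order, $\mathbb{B}_m$ is a minimum generating set for $[\mathbb{Z}/m\mathbb{Z}]_{G,\alpha}$; (2) if for each $i$ the elements of $\mathbb{B}_{p_i^{e_i}}$ are ordered by number of leading zeros from fewest to most and selected in this order, then $\mathbb{B}_m$ is a flow-up minimum generating set for $[\mathbb{Z}/m\mathbb{Z}]_{G,\alpha}$.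
   Context: For a commutative ring $R$, a finite connected graph $G=(V,E)$ and an edge-labeling $\alpha$ assigning to each edge an ideal of $R$, a spline is $\mathbf{f}\in R^{|V|}$ with $\mathbf{f}_u-\mathbf{f}_v\in\alpha(uv)$ for every edge $uv$; splines form a ring $R_{G,\alpha}$. $\rho_{e_i}:\mathbb{Z}/m\mathbb{Z}\to\mathbb{Z}/p_i^{e_i}\mathbb{Z}$ is the quotient map, $\alpha_{e_i}(uv)=\rho_{e_i}(\alpha(uv))$, and $\rho^*:[\mathbb{Z}/m\mathbb{Z}]_{G,\alpha}\to\bigoplus_i[\mathbb{Z}/p_i^{e_i}\mathbb{Z}]_{G,\alpha_{e_i}}$ applies the $\rho_{e_i}$ entrywise (it is an isomorphism). For a prime power $p^e$ and a labeling $\alpha'$ with values in ideals of $\mathbb{Z}/p^e\mathbb{Z}$, the set $\mathbb{B}_{p^e}$ is: for each $1\le\gamma\le e$, reduce labels to $\mathbb{Z}/p^\gamma\mathbb{Z}$; a zero-connected component is a class of vertices joined by paths of edges labeled by the zero ideal; $V^{(i,\gamma)}$ is the zero-connected component (mod $p^\gamma$) whose smallest-index vertex is $v_i$, and $I_\gamma$ the set of such indices $i$ (with $I_0=\emptyset$). Then $\mathbb{B}_{p^e}$ consists, for each $\gamma$ and each $i\in I_\gamma\setminus I_{\gamma-1}$, of the spline over $\mathbb{Z}/p^e\mathbb{Z}$ equal to $p^{\gamma-1}$ on $V^{(i,\gamma)}$ and $0$ elsewhere. The number of leading zeros of a spline $\mathbf{f}$ is the largest $j$ with $\mathbf{f}_{v_1}=\dots=\mathbf{f}_{v_j}=0$.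 A flow-up spline for $v_i$ is a spline with $\mathbf{f}_{v_t}=0$ for $t<i$; a flow-up generating set consists of flow-up splines. A minimum generating set is a generating set with the smallest possible number of elements. *)

(* Defs.v *)
From mathcomp Require Import all_boot all_algebra.

Set Implicit Arguments.
Unset Strict Implicit.
Unset Printing Implicit Defensive.

Import GRing.Theory.
Local Open Scope ring_scope.

(* A simple graph on v_1 < ... < v_n is given by its edge set E; the vertex
   v_(i+1) is i : 'I_n, and uv is an edge iff [set u; v] \in E.  An
   edge-labeling is a function on {set 'I_n}, only its values on E matter. *)

Definition adj (n : nat) (E : {set {set 'I_n}}) : rel 'I_n :=
  fun u v => [set u; v] \in E.

Definition connected_graph (n : nat) (E : {set {set 'I_n}}) : Prop :=
  [/\ (0 < n)%N, forall x, x \in E -> #|x| = 2%N & forall u v, connect (adj E) u v].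

(* Ideals are the submodules of the regular module R^o; the library's
   idealr_closed would exclude the unit ideal. *)
Definition ideal (R : finComNzRingType) (I : {set R}) : Prop :=
  @GRing.submod_closed R R^o [in I].

Definition splines (R : finComNzRingType) (n : nat) (E : {set {set 'I_n}})
    (alpha : {set 'I_n} -> {set R}) : {set 'rV[R]_n} :=
  [set f : 'rV[R]_n |
    [forall u, forall v, adj E u v ==> (f 0 u - f 0 v \in alpha [set u; v])]].

Definition generating_set (R : finComNzRingType) (n : nat)
    (E : {set {set 'I_n}}) (alpha : {set 'I_n} -> {set R})
    (B : {set 'rV[R]_n}) : Prop :=
  B \subset splines E alpha /\
  forall f, f \in splines E alpha ->
    exists c : 'rV[R]_n -> R, f = \sum_(g in B) c g *: g.

Definition minimum_generating_set (R : finComNzRingType) (n : nat)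
    (E : {set {set 'I_n}}) (alpha : {set 'I_n} -> {set R})
    (B : {set 'rV[R]_n}) : Prop :=
  generating_set E alpha B /\
  forall S : {set 'rV[R]_n}, generating_set E alpha S -> (#|B| <= #|S|)%N.

(* The maximum of the j <= n such that the first j entries of f vanish. *)
Definition leading_zeros (R : finComNzRingType) (n : nat) (f : 'rV[R]_n) : nat :=
  (\max_(j < n.+1 | [forall u : 'I_n, (u < j)%N ==> (f 0 u == 0)%R]) j)%N.

Definition flow_up (R : finComNzRingType) (n : nat) (E : {set {set 'I_n}})
    (alpha : {set 'I_n} -> {set R}) (i : 'I_n) (f : 'rV[R]_n) : Prop :=
  f \in splines E alpha /\ forall u : 'I_n, (u < i)%N -> f 0 u = 0.

(* Every spline is a flow-up spline for the first vertex, so merely asking each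
   element of B to be flow-up for some vertex would be vacuous.  The splines of
   B are instead flow-up for pairwise distinct vertices, the spline attached to
   v_i being nonzero at v_i. *)
Definition flow_up_minimum_generating_set (R : finComNzRingType) (n : nat)
    (E : {set {set 'I_n}}) (alpha : {set 'I_n} -> {set R})
    (B : {set 'rV[R]_n}) : Prop :=
  minimum_generating_set E alpha B /\
  exists lead : 'rV[R]_n -> 'I_n,
    {in B &, injective lead} /\
    forall f, f \in B -> flow_up E alpha (lead f) f /\ f 0 (lead f) != 0.

(* The quotient map Z/m -> Z/q, meaningful when q divides m and 1 < q. *)
Definition rho (m q : nat) (a : 'Z_m) : 'Z_q := (a : nat)%:R.
Arguments rho : clear implicits.

Definition reduce_label (m q n : nat) (alpha : {set 'I_n} -> {set 'Z_m}) :
    {set 'I_n} -> {set 'Z_q} :=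
  fun x => rho m q @: alpha x.
Arguments reduce_label [m] q [n] alpha _.

(* In the following p is prime, and 0 < g <= e unless stated otherwise. *)

Definition zero_edge (p e n : nat) (E : {set {set 'I_n}})
    (alpha : {set 'I_n} -> {set 'Z_(p ^ e)}) (g : nat) : rel 'I_n :=
  fun u v => adj E u v && (reduce_label (p ^ g) alpha [set u; v] == [set 0]).

Definition zero_component (p e n : nat) (E : {set {set 'I_n}})
    (alpha : {set 'I_n} -> {set 'Z_(p ^ e)}) (g : nat) (i : 'I_n) : {set 'I_n} :=
  [set j | connect (zero_edge E alpha g) i j].

(* I_g for 0 <= g <= e.  I_0 is empty by convention; the general formula cannot
   be used for it since 'Z_(p ^ 0) is Z/2. *)
Definition min_indices (p e n : nat) (E : {set {set 'I_n}})
    (alpha : {set 'I_n} -> {set 'Z_(p ^ e)}) (g : nat) : {set 'I_n} :=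
  if g is 0 then set0
  else [set i | [forall j in zero_component E alpha g i, (i <= j)%N]].

Definition component_spline (p e n : nat) (E : {set {set 'I_n}})
    (alpha : {set 'I_n} -> {set 'Z_(p ^ e)}) (g : nat) (i : 'I_n) :
    'rV['Z_(p ^ e)]_n :=
  \row_j (if j \in zero_component E alpha g i then (p ^ g.-1)%:R else 0).

(* The level gamma in {1, ..., e} is g.+1 with g : 'I_e. *)
Definition prime_power_splines (p e n : nat) (E : {set {set 'I_n}})
    (alpha : {set 'I_n} -> {set 'Z_(p ^ e)}) : {set 'rV['Z_(p ^ e)]_n} :=
  [set component_spline E alpha g.+1 i
    | g : 'I_e, i : 'I_n in min_indices E alpha g.+1 :\: min_indices E alpha g].

(* The preimage under rho^* of a tuple of splines; it exists and is unique when
   m is the product of the pairwise coprime q i. *)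
Definition rho_star_inv (m t : nat) (q : 'I_t -> nat) (n : nat)
    (E : {set {set 'I_n}}) (alpha : {set 'I_n} -> {set 'Z_m})
    (h : forall i : 'I_t, 'rV['Z_(q i)]_n) : 'rV['Z_m]_n :=
  odflt 0 [pick f in splines E alpha
            | [forall i, map_mx (rho m (q i)) f == h i]].

Definition selection_order (T : finType) (B : {set T}) (s : seq T) : Prop :=
  uniq s /\ s =i B.

(* The k-th selected tuple consists of the k-th elements of the s i, with the
   zero spline where s i is exhausted; the procedure stops once all the s i
   are. *)
Definition procedure_splines (m t : nat) (q : 'I_t -> nat) (n : nat)
    (E : {set {set 'I_n}}) (alpha : {set 'I_n} -> {set 'Z_m})
    (s : forall i : 'I_t, seq 'rV['Z_(q i)]_n) : {set 'rV['Z_m]_n} :=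
  [set rho_star_inv E alpha (fun i => nth 0 (s i) k)
    | k : 'I_(\max_(i < t) size (s i))%N].

(* Main.v *)
Require Import Defs.
From HB Require Import structures.
From mathcomp Require Import all_boot all_algebra.

(** Over Z/p^e the set B_{p^e} is in echelon form.  If a spline f is nonzero
    with first nonzero entry at v_u, take the least g such that u lies in I_g:
    the spline of B_{p^e} attached to (g, u) has p^(g-1) at v_u, and p^(g-1)
    divides f_u because v_u is zero-connected mod p^(g-1) to a smaller vertex,
    where f vanishes.  Eliminating leading entries shows that B_{p^e} generates.
    Since the leading indices of B_{p^e} are distinct, all the coefficients of
    a linear relation are divisible by p; if r < #|B_{p^e}| splines generated,
    factoring B_{p^e} through them and taking a kernel vector mod p would give
    a relation violating this.  The Chinese remainder theorem transfers both
    facts to Z/m.  For sorted selections, the leading index of the k-th spline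
    is the minimum of those of its selected components, so it strictly
    increases with k. *)

Set Implicit Arguments.
Unset Strict Implicit.
Unset Printing Implicit Defensive.

Import GRing.Theory.
Local Open Scope ring_scope.

(** * Reduction maps between the rings Z/m *)

Lemma rho_nat (m q a : nat) (hm : (1 < m)%N) (hq : (1 < q)%N) (hqm : (q %| m)%N) :
  rho m q a%:R = a%:R.
Proof.
by rewrite /rho val_Zp_nat // -(Zp_nat_mod hq) modn_dvdm // Zp_nat_mod.
Qed.

Lemma rho_eq0 (m q : nat) (hq : (1 < q)%N) (a : 'Z_m) :
  (rho m q a == 0) = (q %| a)%N.
Proof. by rewrite /rho -val_eqE /= val_Zp_nat. Qed.

(** Additivity and multiplicativity depend on [q %| m], so the morphism is packed under this
    hypothesis and handed over with an equation; rewriting by that equation lets the [rmorph] lemmas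
    act on [rho]. *)
Lemma rho_rmorphism (m q : nat) (hm : (1 < m)%N) (hq : (1 < q)%N)
    (hqm : (q %| m)%N) :
  {f : {rmorphism 'Z_m -> 'Z_q} | f = rho m q :> ('Z_m -> 'Z_q)}.
Proof.
have rhoD : {morph rho m q : a b / a + b}.
  move=> a b; rewrite -[a]natr_Zp -[b]natr_Zp -natrD.
  by rewrite !rho_nat // natrD.
have rhoM : {morph rho m q : a b / a * b}.
  move=> a b; rewrite -[a]natr_Zp -[b]natr_Zp -natrM.
  by rewrite !rho_nat // natrM.
have rho0 : rho m q 0 = 0 by apply: (rho_nat 0 hm hq hqm).
have rho1 : rho m q 1 = 1 by apply: (rho_nat 1 hm hq hqm).
pose A := GRing.isNmodMorphism.Build _ _ (rho m q) (conj rho0 rhoD).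
pose M := GRing.isMonoidMorphism.Build _ _ (rho m q) (conj rho1 rhoM).
pose f : {rmorphism 'Z_m -> 'Z_q} := HB.pack (rho m q) A M.
by exists f.
Qed.

Lemma rho_comp (m q r : nat) (hm : (1 < m)%N) (hq : (1 < q)%N) (hr : (1 < r)%N)
    (hqm : (q %| m)%N) (hrq : (r %| q)%N) (a : 'Z_m) :
  rho q r (rho m q a) = rho m r a.
Proof. by rewrite -[a]natr_Zp !rho_nat // (dvdn_trans hrq). Qed.

Lemma rho_id (m : nat) (a : 'Z_m) : rho m m a = a.
Proof. exact: natr_Zp. Qed.

Lemma Zp_dvd_natr (m d : nat) (a : 'Z_m) (hd : (d %| a)%N) :
  exists c : 'Z_m, a = c * d%:R.
Proof.
by exists (a %/ d)%:R; rewrite -natrM divnK // natr_Zp.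
Qed.

(** * Ideals, splines and leading indices *)

Lemma ideal0 (R : finComNzRingType) (I : {set R}) : ideal I -> 0 \in I.
Proof. by case. Qed.

Lemma idealMl (R : finComNzRingType) (I : {set R}) (a x : R) :
  ideal I -> x \in I -> a * x \in I.
Proof.
by move=> [I0 IL] Ix; have := IL a x 0 Ix I0; rewrite addr0.
Qed.

Lemma idealD (R : finComNzRingType) (I : {set R}) (x y : R) :
  ideal I -> x \in I -> y \in I -> x + y \in I.
Proof.
by move=> [I0 IL] Ix Iy; have := IL 1 x y Ix Iy; rewrite scale1r.
Qed.

Lemma ideal_sum (R : finComNzRingType) (I : {set R}) (J : finType) (F : J -> R) :
  ideal I -> (forall j, F j \in I) -> \sum_j F j \in I.
Proof.
move=> hI hF; apply: (big_ind (fun x => x \in I)) => [|x y|j _ //].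
- exact: ideal0.
- exact: idealD.
Qed.

Lemma idealN (R : finComNzRingType) (I : {set R}) (x : R) :
  ideal I -> x \in I -> - x \in I.
Proof. by move=> hI Ix; rewrite -mulN1r; apply: idealMl. Qed.

Lemma ideal_rho (m q : nat) (hm : (1 < m)%N) (hq : (1 < q)%N)
    (hqm : (q %| m)%N) (I : {set 'Z_m}) : ideal I -> ideal (rho m q @: I).
Proof.
have [f fE] := rho_rmorphism hm hq hqm; rewrite -fE => hI; split.
  by apply/imsetP; exists 0; rewrite ?ideal0 ?rmorph0.
move=> a _ _ /imsetP[x Ix ->] /imsetP[y Iy ->].
apply/imsetP; exists ((a : nat)%:R * x + y).
  by apply: idealD => //; apply: idealMl.
by rewrite rmorphD rmorphM rmorph_nat natr_Zp.
Qed.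

Lemma splinesP (R : finComNzRingType) (n : nat) (E : {set {set 'I_n}})
    (alpha : {set 'I_n} -> {set R}) (f : 'rV[R]_n) :
  reflect (forall u v, adj E u v -> f 0 u - f 0 v \in alpha [set u; v])
          (f \in splines E alpha).
Proof.
rewrite inE; apply: (iffP 'forall_'forall_implyP) => h u v; exact: h.
Qed.

Lemma splines_sub_scale (R : finComNzRingType) (n : nat) (E : {set {set 'I_n}})
    (alpha : {set 'I_n} -> {set R}) (halpha : forall x, x \in E -> ideal (alpha x))
    (a : R) (f g : 'rV[R]_n) :
  f \in splines E alpha -> g \in splines E alpha ->
  f - a *: g \in splines E alpha.
Proof.
move=> /splinesP hf /splinesP hg; apply/splinesP => u v uv.
have hI := halpha _ uv; rewrite !mxE.
have -> : f 0 u - a * g 0 u - (f 0 v - a * g 0 v) =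
          f 0 u - f 0 v - a * (g 0 u - g 0 v).
  by rewrite mulrBr !opprB addrACA [RHS]addrACA [- f 0 v - _]addrC.
apply: idealD; rewrite ?hf //; apply: idealN => //.
by apply: idealMl => //; apply: hg.
Qed.

(** A relation instead of a function: the zero row then simply has no leading index. *)
Definition leading_index (R : nzRingType) (n : nat) (f : 'rV[R]_n) (u : 'I_n) : bool :=
  (f 0 u != 0) && [forall v : 'I_n, (v < u)%N ==> (f 0 v == 0)].

Lemma leading_indexP (R : nzRingType) (n : nat) (f : 'rV[R]_n) (u : 'I_n) :
  reflect (f 0 u != 0 /\ forall v : 'I_n, (v < u)%N -> f 0 v = 0)
          (leading_index f u).
Proof.
apply: (iffP andP) => -[fu f0]; split=> //.
  by move=> v vu; apply/eqP; move/forallP: f0 => /(_ v)/implyP; apply.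
by apply/forallP=> v; apply/implyP=> /f0 ->.
Qed.

Lemma leading_index_le (R : nzRingType) (n : nat) (f : 'rV[R]_n) (u v : 'I_n) :
  leading_index f u -> f 0 v != 0 -> (u <= v)%N.
Proof.
case/leading_indexP=> _ f0; apply: contraNT; rewrite -ltnNge => /f0 ->;
by rewrite eqxx.
Qed.

Lemma leading_index_uniq (R : nzRingType) (n : nat) (f : 'rV[R]_n) (u v : 'I_n) :
  leading_index f u -> leading_index f v -> u = v.
Proof.
move=> hu hv; apply/val_inj/eqP; rewrite eqn_leq.
have [fu _] := leading_indexP _ _ hu; have [fv _] := leading_indexP _ _ hv.
by rewrite (leading_index_le hu fv) (leading_index_le hv fu).
Qed.

Lemma ex_leading_index (R : nzRingType) (n : nat) (f : 'rV[R]_n) :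
  f != 0 -> exists u, leading_index f u.
Proof.
case/matrix0Pn=> i [j]; rewrite ord1 => fj.
case: (@arg_minnP _ j (fun u => f 0 u != 0) (fun u : 'I_n => u : nat) fj) => u fu hu.
exists u; apply/leading_indexP; split=> // v; rewrite ltnNge => vu.
by apply/eqP; apply: contraNT vu => /hu.
Qed.

Lemma leading_zeros_leading_index (R : finComNzRingType) (n : nat)
    (f : 'rV[R]_n) (u : 'I_n) : leading_index f u -> leading_zeros f = u.
Proof.
case/leading_indexP=> fu f0; apply/eqP; rewrite eqn_leq; apply/andP; split.
  apply/bigmax_leqP => j /forallP/(_ u)/implyP h; rewrite leqNgt.
  by apply: contraNN fu => /h.
have hu : (u < n.+1)%N := leqW (ltn_ord u).
apply: (leq_bigmax_cond (Ordinal hu)).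
by apply/forallP=> v; apply/implyP=> /f0 ->.
Qed.

(** * The splines of B_{p^e} *)

Lemma expn_gt1 (p g : nat) : (1 < p)%N -> (0 < g)%N -> (1 < p ^ g)%N.
Proof. by move=> hp hg; rewrite -{1}(expn0 p) ltn_exp2l. Qed.

(** The ideals of Z/p^e form a chain: gcd(p^e, a) is some p^k with k < g, it is a multiple of [a]
    modulo p^e by Bezout, and it divides p^(g-1). *)
Lemma Zp_dvd_pow (p e g : nat) (hp : prime p) (hg : (0 < g <= e)%N)
    (a : 'Z_(p ^ e)) (ha : ~~ (p ^ g %| a)%N) :
  exists c, c * a = (p ^ g.-1)%:R.
Proof.
have [g0 ge] := andP hg.
have q1 : (1 < p ^ e)%N by rewrite expn_gt1 ?prime_gt1 // (leq_trans g0).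
have q0 : (0 < p ^ e)%N by apply: ltnW.
have := dvdn_gcdl (p ^ e) a.
case/(dvdn_pfactor _ _ hp)=> k ke gcdE.
have kg : (k <= g.-1)%N.
  rewrite -ltnS prednK // ltnNge; apply: contraNN ha => gk.
  by apply: (dvdn_trans (dvdn_exp2l p gk)); rewrite -gcdE dvdn_gcdr.
(* Bezout in the form: p^e divides gcd(p^e, a) + c a. Hence the coefficient [- c%:R] below. *)
have [c _ /dvdnP[d dE]] := Bezoutl a q0.
have pk : (p ^ k)%:R = - c%:R * a.
  apply/eqP; rewrite mulNr -addr_eq0 -[a in _ * a]natr_Zp -natrM -natrD -gcdE dE.
  by rewrite natrM -(Zp_nat_mod q1 (p ^ e)) modnn mulr0.
exists ((p ^ (g.-1 - k))%:R * - c%:R).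
by rewrite -mulrA -pk -natrM -expnD subnK.
Qed.

Lemma zero_component_edge (p e n : nat) (E : {set {set 'I_n}})
    (alpha : {set 'I_n} -> {set 'Z_(p ^ e)}) (g : nat) (i u v : 'I_n) :
  u \in zero_component E alpha g i -> v \notin zero_component E alpha g i ->
  ~~ zero_edge E alpha g u v.
Proof.
rewrite !inE => iu; apply: contraNN => uv.
by apply: connect_trans iu (connect1 uv).
Qed.

(** An edge leaving the component has a nonzero label mod p^g. The label thus contains an element
    not divisible by p^g, and with it p^(g-1), the jump of the spline across the edge. *)
Lemma component_spline_splines (p e n : nat) (hp : prime p) (E : {set {set 'I_n}})
    (alpha : {set 'I_n} -> {set 'Z_(p ^ e)})
    (halpha : forall x, x \in E -> ideal (alpha x))
    (g : nat) (hg : (0 < g <= e)%N) (i : 'I_n) :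
  component_spline E alpha g i \in splines E alpha.
Proof.
have [g0 ge] := andP hg.
have cut u v : adj E u v -> u \in zero_component E alpha g i ->
    v \notin zero_component E alpha g i -> (p ^ g.-1)%:R \in alpha [set u; v].
  move=> uv iu iv; have hI := halpha _ uv.
  have := zero_component_edge iu iv; rewrite /zero_edge uv /= => nz.
  suff [a Ia ha] : exists2 a, a \in alpha [set u; v] & ~~ (p ^ g %| a)%N.
    by have [c <-] := Zp_dvd_pow hp hg ha; apply: idealMl.
  apply/exists_inP; apply: contraNT nz; rewrite negb_exists_in => /forall_inP h.
  have g1 : (1 < p ^ g)%N by rewrite expn_gt1 ?prime_gt1.
  rewrite eqEsubset; apply/andP; split; apply/subsetP => y; last first.
    rewrite inE => /eqP->; apply/imsetP; exists 0; first exact: ideal0.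
    by apply/esym/eqP; rewrite rho_eq0 //.
  case/imsetP=> a Ia ->; rewrite inE rho_eq0 //.
  by have := h a Ia; rewrite negbK.
apply/splinesP=> u v uv; rewrite !mxE; have hI := halpha _ uv.
case: ifPn => iu; case: ifPn => iv; rewrite ?subrr ?sub0r ?subr0 ?ideal0 //.
  exact: cut.
apply: idealN => //; rewrite setUC; apply: cut => //.
by rewrite /adj setUC.
Qed.

(** Along a path of zero edges, every difference of consecutive entries lies in a label that reduces
    to 0 mod p^g. *)
Lemma rho_zero_component (p e n : nat) (hp : prime p) (E : {set {set 'I_n}})
    (alpha : {set 'I_n} -> {set 'Z_(p ^ e)})
    (g : nat) (hg : (0 < g <= e)%N) (f : 'rV['Z_(p ^ e)]_n) (u v : 'I_n) :
  f \in splines E alpha -> v \in zero_component E alpha g u ->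
  rho (p ^ e) (p ^ g) (f 0 u) = rho (p ^ e) (p ^ g) (f 0 v).
Proof.
move=> /splinesP hf; rewrite inE => uv; have [g0 ge] := andP hg.
have g1 : (1 < p ^ g)%N by rewrite expn_gt1 ?prime_gt1.
have e1 : (1 < p ^ e)%N by rewrite expn_gt1 ?prime_gt1 // (leq_trans g0).
have [r rE] := rho_rmorphism e1 g1 (dvdn_exp2l p ge); rewrite -rE.
have /connectP[s + ->] := uv; elim: s u {uv} => //= w s IH u /andP[uw /IH <-].
case/andP: uw => /hf Iuw /eqP/setP/(_ (r (f 0 u - f 0 w))).
rewrite /reduce_label -rE imset_f // inE => /esym/eqP/eqP.
by rewrite rmorphB subr_eq0 => /eqP.
Qed.

(** A zero edge mod p^h is also one mod p^g, so components shrink as the level rises, and the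
    smallest vertex of a component remains the smallest of its part. *)
Lemma min_indices_homo (p e n : nat) (hp : prime p) (E : {set {set 'I_n}})
    (alpha : {set 'I_n} -> {set 'Z_(p ^ e)})
    (halpha : forall x, x \in E -> ideal (alpha x))
    (g h : nat) (hh : (h <= e)%N) : (g <= h)%N ->
  min_indices E alpha g \subset min_indices E alpha h.
Proof.
case: g => [|g]; first by rewrite sub0set.
case: h hh => // h he gh; apply/subsetP=> i; rewrite !inE => /forall_inP hi.
apply/forall_inP=> j ij; apply: hi; rewrite inE in ij.
move: j ij.
suff sub : subrel (zero_edge E alpha h.+1) (connect (zero_edge E alpha g.+1)).
  by move=> j ij; rewrite inE; apply: (connect_sub sub).
move=> u v /andP[uv /eqP z]; apply: connect1.
rewrite /zero_edge uv /=; have hI := halpha _ uv.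
have p1 := prime_gt1 hp.
have comp a : rho (p ^ h.+1) (p ^ g.+1) (rho (p ^ e) (p ^ h.+1) a) =
    rho (p ^ e) (p ^ g.+1) a.
  by apply: rho_comp; rewrite ?expn_gt1 ?dvdn_exp2l // (leq_trans _ he).
have rho0 : rho (p ^ h.+1) (p ^ g.+1) 0 = 0.
  by apply/eqP; rewrite rho_eq0 ?expn_gt1.
rewrite eqEsubset; apply/andP; split; apply/subsetP => y; last first.
  rewrite inE => /eqP->; apply/imsetP; exists 0; first exact: ideal0.
  by apply/esym/eqP; rewrite rho_eq0 ?expn_gt1.
case/imsetP=> a Ia ->; rewrite inE -comp.
have := imset_f (rho (p ^ e) (p ^ h.+1)) Ia.
by rewrite -/(reduce_label _ alpha _) z inE => /eqP->; rewrite rho0.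
Qed.

Lemma Zp_expn_neq0 (p e g : nat) (hp : prime p) (hg : (g < e)%N) :
  (p ^ g)%:R != 0 :> 'Z_(p ^ e).
Proof.
have p1 := prime_gt1 hp.
rewrite -val_eqE /= val_Zp_nat ?expn_gt1 ?(leq_ltn_trans _ hg) //.
by rewrite -/(dvdn _ _) dvdn_Pexp2l // -ltnNge.
Qed.

Lemma leading_index_component_spline (p e n : nat) (hp : prime p)
    (E : {set {set 'I_n}}) (alpha : {set 'I_n} -> {set 'Z_(p ^ e)})
    (g : nat) (hg : (0 < g <= e)%N) (i : 'I_n) :
  i \in min_indices E alpha g ->
  leading_index (component_spline E alpha g i) i.
Proof.
case: g hg => // g /= ge; rewrite inE => /forall_inP hi.
apply/leading_indexP; split=> [|v vi]; rewrite mxE.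
  by rewrite inE connect0 Zp_expn_neq0.
by case: ifPn => // /hi; rewrite leqNgt vi.
Qed.

Lemma prime_power_splinesP (p e n : nat) (E : {set {set 'I_n}})
    (alpha : {set 'I_n} -> {set 'Z_(p ^ e)}) (b : 'rV['Z_(p ^ e)]_n) :
  reflect (exists g i, [/\ (0 < g <= e)%N, i \in min_indices E alpha g,
             i \notin min_indices E alpha g.-1 & b = component_spline E alpha g i])
          (b \in prime_power_splines E alpha).
Proof.
apply: (iffP imset2P) => [[g i _ /setDP[ig ig1] ->]|[[|g] [i [ge ig ig1 ->]]]] //.
  by exists g.+1, i; split=> //=; apply: ltn_ord.
by exists (Ordinal ge) i => //; apply/setDP.
Qed.

(** The sets I_g increase with g, so a vertex lies in I_g but not in I_(g-1) for at most one g: the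
    leading index determines the level too. *)
Lemma prime_power_splines_leading_inj (p e n : nat) (hp : prime p)
    (E : {set {set 'I_n}}) (alpha : {set 'I_n} -> {set 'Z_(p ^ e)})
    (halpha : forall x, x \in E -> ideal (alpha x))
    (b c : 'rV['Z_(p ^ e)]_n) (u : 'I_n) :
  b \in prime_power_splines E alpha -> c \in prime_power_splines E alpha ->
  leading_index b u -> leading_index c u -> b = c.
Proof.
case/prime_power_splinesP=> g [i [ge ig ig1 ->]].
case/prime_power_splinesP=> h [j [he jh jh1 ->]].
move=> /(leading_index_uniq (leading_index_component_spline hp ge ig)) iu.
move=> /(leading_index_uniq (leading_index_component_spline hp he jh)) ju.
rewrite {j}ju in jh jh1 *; rewrite {i}iu in ig ig1 *.
case/andP: ge => g0 ge; case/andP: he => h0 he.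
have mono := min_indices_homo hp halpha.
case: (ltngtP g h) => [gh|hg|-> //].
- have gh1 : (g <= h.-1)%N by rewrite -ltnS prednK.
  by case/negP: jh1; apply: (subsetP (mono _ _ (leq_trans (leq_pred h) he) gh1)).
have hg1 : (h <= g.-1)%N by rewrite -ltnS prednK.
by case/negP: ig1; apply: (subsetP (mono _ _ (leq_trans (leq_pred g) ge) hg1)).
Qed.

(* If u is not a minimal index mod p^g, then u is zero-connected mod p^g to a
   smaller vertex, where f vanishes. *)
Lemma rho_leading_index (p e n : nat) (hp : prime p)
    (E : {set {set 'I_n}}) (alpha : {set 'I_n} -> {set 'Z_(p ^ e)})
    (g : nat) (hg : (0 < g <= e)%N) (f : 'rV['Z_(p ^ e)]_n) (u : 'I_n) :
  f \in splines E alpha -> leading_index f u -> u \notin min_indices E alpha g ->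
  (p ^ g %| f 0%R u)%N.
Proof.
case: g hg => // g ge fS /leading_indexP[_ f0].
rewrite inE negb_forall_in => /exists_inP[v uv]; rewrite -ltnNge => /f0 fv.
have p1 := prime_gt1 hp.
rewrite -rho_eq0 ?expn_gt1 // (rho_zero_component hp ge fS uv) fv.
by rewrite rho_eq0 ?expn_gt1.
Qed.

(** The elimination step: some multiple of an element of B_{p^e} has the same leading entry as
    [f]. *)
Lemma prime_power_splines_dvd (p e n : nat) (hp : prime p) (he : (0 < e)%N)
    (E : {set {set 'I_n}}) (alpha : {set 'I_n} -> {set 'Z_(p ^ e)})
    (f : 'rV['Z_(p ^ e)]_n) (u : 'I_n) :
  f \in splines E alpha -> leading_index f u ->
  exists b c, [/\ b \in prime_power_splines E alpha, leading_index b u &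
                  f 0 u = c * b 0 u].
Proof.
move=> fS fu; have [fu0 _] := leading_indexP _ _ fu.
have p1 := prime_gt1 hp.
(* Level e qualifies: if [u] were not in I_e, then p^e would divide f_u, forcing f_u = 0. *)
have ex : exists g, (0 < g <= e)%N && (u \in min_indices E alpha g).
  exists e; rewrite he leqnn /=; apply: contraNT fu0 => nu.
  have := rho_leading_index hp _ fS fu nu; rewrite he leqnn => /(_ isT).
  by rewrite -rho_eq0 ?expn_gt1 // rho_id.
case: (ex_minnP ex) => g /andP[hg ug] gmin.
have [g0 ge] := andP hg.
have ug1 : u \notin min_indices E alpha g.-1.
  case: (posnP g.-1) => [-> | g1]; first by rewrite inE.
  apply/negP=> ug1; have := gmin g.-1; rewrite g1 ug1 (leq_trans (leq_pred g)) //.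
  by rewrite -ltnS prednK // ltnn => /(_ isT).
have bE : component_spline E alpha g u 0 u = (p ^ g.-1)%:R.
  by rewrite mxE inE connect0.
have [c fE] : exists c, f 0 u = c * (p ^ g.-1)%:R.
  (* For g = 1 the divisor is p^0 = 1; [rho_leading_index] handles positive levels. *)
  apply: Zp_dvd_natr; case: (posnP g.-1) => [-> | g1]; first by rewrite dvd1n.
  apply: (rho_leading_index hp _ fS fu ug1).
  by rewrite g1 (leq_trans (leq_pred g)).
exists (component_spline E alpha g u), c; split; last by rewrite bE.
  by apply/prime_power_splinesP; exists g, u.
exact: leading_index_component_spline.
Qed.

(** * Generation and minimality over Z/p^e *)

(** Rows beyond the end of [s] are zero, which matches the zero splines used for exhausted
    selections and allows one common [N] for all primes. *)
Definition seq_rows (R : nzRingType) (n N : nat) (s : seq 'rV[R]_n) : 'M[R]_(N, n) :=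
  \matrix_(k < N) nth 0 s k.
Arguments seq_rows [R n] N s.

Lemma prime_power_splines_generate (p e n : nat) (hp : prime p) (he : (0 < e)%N)
    (E : {set {set 'I_n}}) (alpha : {set 'I_n} -> {set 'Z_(p ^ e)})
    (halpha : forall x, x \in E -> ideal (alpha x))
    (s : seq 'rV['Z_(p ^ e)]_n) (hs : s =i prime_power_splines E alpha)
    (N : nat) (hN : (size s <= N)%N) (f : 'rV['Z_(p ^ e)]_n) :
  f \in splines E alpha -> exists c, f = c *m seq_rows N s.
Proof.
(* Induction on the number [d] of last vertices at which [g] may be nonzero; for d = n the vanishing
   condition is empty. *)
move=> fS; suff gen d g : g \in splines E alpha ->
    (forall v : 'I_n, (v + d < n)%N -> g 0 v = 0) -> exists c, g = c *m seq_rows N s.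
  by apply: (gen n) => // v; rewrite ltnNge leq_addl.
elim: d g {f fS} => [|d IH] f fS f0.
  exists 0; rewrite mul0mx; apply/rowP=> v; rewrite mxE f0 //.
  by rewrite addn0.
have [->|/ex_leading_index[u fu]] := eqVneq f 0; first by exists 0; rewrite mul0mx.
have [b [c [bB bu fbu]]] := prime_power_splines_dvd hp he fS fu.
have bs : b \in s by rewrite hs.
have bS : b \in splines E alpha.
  by case/prime_power_splinesP: bB => g [i [hg _ _ ->]]; apply: component_spline_splines.
have [a aE] : exists a, f - c *: b = a *m seq_rows N s.
  apply: IH => [|v vd]; first exact: splines_sub_scale.
  have [fu0 fz] := leading_indexP _ _ fu; have [_ bz] := leading_indexP _ _ bu.
  rewrite !mxE; case: (ltngtP v u) => [vu|uv|/val_inj->].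
  - by rewrite fz // bz // mulr0 subr0.
  (* A vertex v > u with v + d < n would give u + d.+1 < n, and [f] would vanish at [u]. *)
  - case/eqP: fu0; apply: f0; rewrite addnS -addSn.
    by apply: leq_ltn_trans vd; rewrite leq_add2r.
  - by rewrite fbu subrr.
have kN : (index b s < N)%N by rewrite (leq_trans _ hN) ?index_mem.
exists (a + c *: delta_mx 0 (Ordinal kN)).
rewrite mulmxDl -aE -scalemxAl -rowE rowK nth_index //.
by rewrite subrK.
Qed.

(** Since every entry is 0 or the leading one, a scalar that kills the leading entry kills the whole
    spline. *)
Lemma prime_power_splines_entries (p e n : nat) (hp : prime p)
    (E : {set {set 'I_n}}) (alpha : {set 'I_n} -> {set 'Z_(p ^ e)})
    (b : 'rV['Z_(p ^ e)]_n) :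
  b \in prime_power_splines E alpha ->
  exists u, leading_index b u /\ forall v, b 0 v = 0 \/ b 0 v = b 0 u.
Proof.
case/prime_power_splinesP=> g [i [hg ig _ ->]]; exists i.
split=> [|v]; first exact: leading_index_component_spline.
by rewrite !mxE [i \in _]inE connect0; case: ifP; [right|left].
Qed.

(* Distinct leading indices: evaluating the relation at the leading index of
   the k-th spline, by induction on this index, leaves only the k-th term. *)
Lemma prime_power_splines_relation (p e n : nat) (hp : prime p) (he : (0 < e)%N)
    (E : {set {set 'I_n}}) (alpha : {set 'I_n} -> {set 'Z_(p ^ e)})
    (halpha : forall x, x \in E -> ideal (alpha x))
    (s : seq 'rV['Z_(p ^ e)]_n) (us : uniq s) (hs : s =i prime_power_splines E alpha)
    (a : 'rV_(size s)) (k : 'I_(size s)) :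
  a *m seq_rows (size s) s = 0 -> (p %| a 0%R k)%N.
Proof.
move=> rel.
have sB (j : 'I_(size s)) : nth 0 s j \in prime_power_splines E alpha.
  by rewrite -hs mem_nth.
(* The induction carries the vanishing of the whole row a_j b_j, so that rows with smaller leading
   index drop out of the relation at [u]. *)
have tz d : forall (j : 'I_(size s)) (u : 'I_n), leading_index (nth 0 s j) u ->
    (u < d)%N -> a 0 j *: nth 0 s j = 0.
  elim: d => // d IH j u ju ud.
  have [u' [ju' vals]] := prime_power_splines_entries hp (sB j).
  rewrite (leading_index_uniq ju' ju) in vals.
  have : (a *m seq_rows (size s) s) 0 u = 0 by rewrite rel mxE.
  rewrite mxE (bigD1 j) //= big1 => [|l lj]; last first.
    have [w [lw _]] := prime_power_splines_entries hp (sB l).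
    rewrite mxE; case: (ltngtP w u) => [wu|uw|/val_inj wu].
    - have /rowP/(_ u) := IH l w lw (leq_trans wu ud).
      by rewrite !mxE.
    - by have [_ -> //] := leading_indexP _ _ lw; rewrite mulr0.
    rewrite wu in lw.
    have /eqP := prime_power_splines_leading_inj hp halpha (sB l) (sB j) lw ju.
    by rewrite nth_uniq // => /eqP/val_inj ljE; rewrite ljE eqxx in lj.
  rewrite addr0 mxE => au; apply/rowP=> v; rewrite !mxE.
  by case: (vals v) => ->; rewrite ?mulr0.
have [u [ku _]] := prime_power_splines_entries hp (sB k).
have /rowP/(_ u) := tz _ k u ku (leqnn _); rewrite !mxE => au.
have [ku0 _] := leading_indexP _ _ ku.
apply: contraNT ku0 => pa.
have aunit : a 0 k \is a GRing.unit.
  rewrite -[a 0 k]natr_Zp unitZpE ?expn_gt1 ?prime_gt1 //.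
  by rewrite coprime_pexpl // prime_coprime.
by rewrite -(mulKr aunit (nth 0 s k 0 u)) au mulr0.
Qed.

Lemma prime_power_splines_min (p e n : nat) (hp : prime p) (he : (0 < e)%N)
    (E : {set {set 'I_n}}) (alpha : {set 'I_n} -> {set 'Z_(p ^ e)})
    (halpha : forall x, x \in E -> ideal (alpha x))
    (s : seq 'rV['Z_(p ^ e)]_n) (us : uniq s) (hs : s =i prime_power_splines E alpha)
    (r : nat) (S : 'M['Z_(p ^ e)]_(r, n)) :
  (forall j, row j S \in splines E alpha) ->
  (forall b, b \in prime_power_splines E alpha -> exists c, b = c *m S) ->
  (size s <= r)%N.
Proof.
move=> hS hB; rewrite leqNgt; apply/negP => rN.
set N := size s in rN *; pose M := seq_rows N s.
have [A AE] : exists A : 'M_(N, r), M = A *m S.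
  have /fin_all_exists[A hA] : forall k, exists c : 'rV_r, row k M = c *m S.
    move=> k; rewrite rowK; apply: hB; rewrite -hs; apply: mem_nth.
    exact: ltn_ord.
  by exists (\matrix_k A k); apply/row_matrixP=> k; rewrite hA row_mul rowK.
have [C CE] : exists C : 'M_(r, N), S = C *m M.
  have /fin_all_exists[C hC] : forall j, exists c : 'rV_N, row j S = c *m M.
    by move=> j; apply: (prime_power_splines_generate hp he halpha hs (leqnn _)).
  by exists (\matrix_j C j); apply/row_matrixP=> j; rewrite row_mul rowK.
have p1 := prime_gt1 hp.
have q1 : (1 < p ^ e)%N by rewrite expn_gt1.
(* The field ['F_p] is ['Z_(pdiv p)], so the reduction map is built with target modulus [pdiv p]. *)
have pd : pdiv p = p by apply: pdiv_id.
have d1 : (1 < pdiv p)%N by rewrite pd.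
have pq : (pdiv p %| p ^ e)%N by rewrite pd dvdn_exp.
have [pi piE] := rho_rmorphism q1 d1 pq.
have pi0 x : (pi x == 0) = (p %| x)%N by rewrite piE rho_eq0 // pd.
(* Mod p, [A] has more rows than columns, hence a nonzero left kernel vector over the field. *)
have [v vA v0] : exists2 v : 'rV['F_p]_N, v *m map_mx pi A = 0 & v != 0.
  have : kermx (map_mx pi A) != 0.
    rewrite kermx_eq0 /row_free; apply/negP => /eqP rk.
    by have := rank_leq_col (map_mx pi A); rewrite rk leqNgt rN.
  by case/rowV0Pn=> v /sub_kermxP vA v0; exists v.
pose vt : 'rV['Z_(p ^ e)]_N := map_mx (fun x : 'F_p => (x : nat)%:R) v.
have pivt : map_mx pi vt = v.
  by apply/rowP=> k; rewrite !mxE rmorph_nat natr_Zp.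
have [w wE] : exists w : 'rV_r, vt *m A = p%:R *: w.
  have /fin_all_exists[w hw] : forall j, exists c, (vt *m A) 0 j = c * p%:R.
    move=> j; apply: Zp_dvd_natr; rewrite -pi0.
    have : map_mx pi (vt *m A) 0 j = 0 by rewrite map_mxM pivt vA mxE.
    by rewrite mxE => ->.
  by exists (\row_j w j); apply/rowP=> j; rewrite hw !mxE mulrC.
(* vt M = vt A S = p w S = p w C M. The coefficients of this relation reduce to [v] mod p and are
   all divisible by p, so v = 0. *)
have rel : (vt - p%:R *: (w *m C)) *m M = 0.
  by rewrite mulmxBl -scalemxAl -mulmxA -CE scalemxAl -wE AE mulmxA subrr.
case/eqP: v0; apply/rowP=> k; rewrite -pivt [LHS]mxE [RHS]mxE.
have := prime_power_splines_relation hp he halpha us hs k rel.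
have -> : (vt - p%:R *: (w *m C)) 0 k = vt 0 k - p%:R * (w *m C) 0 k.
  by rewrite !mxE.
rewrite -pi0 rmorphB rmorphM.
have -> : pi p%:R = 0.
  by rewrite rmorph_nat; apply/eqP; rewrite -(dvdn_pcharf (pchar_Fp hp)).
by rewrite mul0r subr0 => /eqP.
Qed.

(** * Chinese remaindering *)

Lemma coprime_prodr (I : Type) (r : seq I) (P : pred I) (F : I -> nat) (a : nat) :
  (forall i, P i -> coprime a (F i)) -> coprime a (\prod_(i <- r | P i) F i).
Proof.
move=> h; apply: (big_ind (coprime a)) => [|x y ax ay|//].
- exact: coprimen1.
- by rewrite coprimeMr ax.
Qed.

Lemma prod_coprime_dvd (I : eqType) (r : seq I) (F : I -> nat) (a : nat) :
  uniq r -> {in r &, forall i j, i != j -> coprime (F i) (F j)} ->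
  {in r, forall i, F i %| a}%N -> (\prod_(i <- r) F i %| a)%N.
Proof.
elim: r => [|i r IH] /=; first by rewrite big_nil dvd1n.
case/andP=> ir ur cop dv; rewrite big_cons Gauss_dvd.
  have ri j : j \in r -> j \in i :: r by rewrite inE orbC => ->.
  rewrite dv ?mem_head // IH // => [j k /ri jr /ri kr|j /ri].
    exact: cop.
  exact: dv.
rewrite big_seq; apply: coprime_prodr => j jr.
by apply: cop; rewrite ?mem_head ?inE ?jr ?orbT //; apply: contraNneq ir => ->.
Qed.

Lemma rho_inj (m t : nat) (q : 'I_t -> nat) (hm : (1 < m)%N)
    (hq : forall i, (1 < q i)%N)
    (cop : forall i j, i != j -> coprime (q i) (q j))
    (hdec : m = (\prod_(i < t) q i)%N) (a b : 'Z_m) :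
  (forall i, rho m (q i) a = rho m (q i) b) -> a = b.
Proof.
move=> ab; apply/eqP; rewrite -subr_eq0 -[a - b]rho_id rho_eq0 //.
rewrite {1}hdec; apply: prod_coprime_dvd => [|i j _ _|i _].
- exact: index_enum_uniq.
- exact: cop.
have qm : (q i %| m)%N by rewrite hdec (bigD1 i) //= dvdn_mulr.
have [f fE] := rho_rmorphism hm (hq i) qm.
by rewrite -rho_eq0 // -fE rmorphB fE ab subrr.
Qed.

(** These are the orthogonal idempotents of the Chinese remainder decomposition, used below as
    weights to glue local data. *)
Lemma rho_idempotent (m t : nat) (q : 'I_t -> nat) (hm : (1 < m)%N)
    (hq : forall i, (1 < q i)%N)
    (cop : forall i j, i != j -> coprime (q i) (q j))
    (hdec : m = (\prod_(i < t) q i)%N) (i : 'I_t) :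
  exists u : 'Z_m, forall j, rho m (q j) u = (j == i)%:R.
Proof.
pose Q := (\prod_(j < t | j != i) q j)%N.
have cQ : coprime (q i) Q.
  by apply: coprime_prodr => j ji; apply: cop; rewrite eq_sym.
exists (chinese (q i) Q 1 0)%:R => j.
have qm : (q j %| m)%N by rewrite hdec (bigD1 j) //= dvdn_mulr.
rewrite rho_nat //; have [->|ji] := eqVneq j i.
  by rewrite -(Zp_nat_mod (hq i)) chinese_modl // Zp_nat_mod.
apply/eqP; rewrite -val_eqE /= val_Zp_nat // -/(dvdn _ _).
have qQ : (q j %| Q)%N by rewrite /Q (bigD1 j) //= dvdn_mulr.
apply: (dvdn_trans qQ); rewrite /dvdn chinese_modr //.
by rewrite mod0n.
Qed.

Lemma rho_surj (m t : nat) (q : 'I_t -> nat) (hm : (1 < m)%N)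
    (hq : forall i, (1 < q i)%N)
    (cop : forall i j, i != j -> coprime (q i) (q j))
    (hdec : m = (\prod_(i < t) q i)%N) (h : forall i, 'Z_(q i)) :
  exists u : 'Z_m, forall j, rho m (q j) u = h j.
Proof.
have [ep epE] := fin_all_exists (rho_idempotent hm hq cop hdec).
exists (\sum_i ep i * (h i : nat)%:R) => j.
have qm : (q j %| m)%N by rewrite hdec (bigD1 j) //= dvdn_mulr.
have [f fE] := rho_rmorphism hm (hq j) qm.
rewrite -fE rmorph_sum (bigD1 j) //= big1 => [|i ij].
  by rewrite rmorphM rmorph_nat natr_Zp fE epE eqxx mul1r addr0.
by rewrite rmorphM fE epE eq_sym (negPf ij) mul0r.
Qed.

(** Choose b_i in [I] with the residue of [a] mod q_i; the idempotent-weighted sum of the b_i lies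
    in [I] and has all the residues of [a]. *)
Lemma ideal_rhoP (m t : nat) (q : 'I_t -> nat) (hm : (1 < m)%N)
    (hq : forall i, (1 < q i)%N)
    (cop : forall i j, i != j -> coprime (q i) (q j))
    (hdec : m = (\prod_(i < t) q i)%N) (I : {set 'Z_m}) (a : 'Z_m) :
  ideal I -> (forall i, rho m (q i) a \in rho m (q i) @: I) -> a \in I.
Proof.
move=> hI ha; have [ep epE] := fin_all_exists (rho_idempotent hm hq cop hdec).
have /fin_all_exists[b hb] : forall i,
    exists b : 'Z_m, b \in I /\ rho m (q i) a = rho m (q i) b.
  by move=> i; have /imsetP[b Ib ->] := ha i; exists b.
suff -> : a = \sum_i ep i * b i.
  by apply: ideal_sum => // i; apply: idealMl => //; case: (hb i).
apply: (rho_inj hm hq cop hdec) => j.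
have qm : (q j %| m)%N by rewrite hdec (bigD1 j) //= dvdn_mulr.
have [_ ->] := hb j; have [f fE] := rho_rmorphism hm (hq j) qm.
rewrite -fE rmorph_sum (bigD1 j) //= big1 => [|i ij].
  by rewrite rmorphM fE epE eqxx mul1r addr0.
by rewrite rmorphM fE epE eq_sym (negPf ij) mul0r.
Qed.

Lemma map_rho_splines (m q n : nat) (hm : (1 < m)%N) (hq : (1 < q)%N)
    (hqm : (q %| m)%N) (E : {set {set 'I_n}}) (alpha : {set 'I_n} -> {set 'Z_m})
    (f : 'rV['Z_m]_n) :
  f \in splines E alpha -> map_mx (rho m q) f \in splines E (reduce_label q alpha).
Proof.
move=> /splinesP fS; apply/splinesP => u v uv; rewrite !mxE.
have [r rE] := rho_rmorphism hm hq hqm.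
by rewrite -rE -rmorphB /reduce_label -rE imset_f // fS.
Qed.

(** The default 0 in [rho_star_inv] is never reached: gluing entrywise gives a preimage, whose edge
    conditions hold because ideal membership can be tested modulo each q_i. *)
Lemma rho_star_invP (m t : nat) (q : 'I_t -> nat) (hm : (1 < m)%N)
    (hq : forall i, (1 < q i)%N)
    (cop : forall i j, i != j -> coprime (q i) (q j))
    (hdec : m = (\prod_(i < t) q i)%N)
    (n : nat) (E : {set {set 'I_n}}) (alpha : {set 'I_n} -> {set 'Z_m})
    (halpha : forall x, x \in E -> ideal (alpha x))
    (h : forall i, 'rV['Z_(q i)]_n) :
  (forall i, h i \in splines E (reduce_label (q i) alpha)) ->
  rho_star_inv E alpha h \in splines E alpha /\
  forall i, map_mx (rho m (q i)) (rho_star_inv E alpha h) = h i.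
Proof.
move=> hS; rewrite /rho_star_inv; case: pickP => [f /andP[fS /forallP fh]|none] /=.
  by split=> // i; apply/eqP.
have /fin_all_exists[f hf] : forall u,
    exists a : 'Z_m, forall i, rho m (q i) a = h i 0 u.
  by move=> u; apply: (rho_surj hm hq cop hdec).
have [] := elimF andP (none (\row_u f u)); split; last first.
  by apply/forallP=> i; apply/eqP/rowP=> u; rewrite !mxE hf.
apply/splinesP=> u v uv; rewrite !mxE.
apply: (ideal_rhoP hm hq cop hdec); first exact: halpha.
move=> i; have qm : (q i %| m)%N by rewrite hdec (bigD1 i) //= dvdn_mulr.
have [r rE] := rho_rmorphism hm (hq i) qm.
rewrite -{1}rE rmorphB rE !hf.
by have /splinesP := hS i; apply.
Qed.

Lemma splines0 (R : finComNzRingType) (n : nat) (E : {set {set 'I_n}})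
    (alpha : {set 'I_n} -> {set R}) (halpha : forall x, x \in E -> ideal (alpha x)) :
  0 \in splines E alpha.
Proof.
by apply/splinesP=> u v uv; rewrite !mxE subrr ideal0 //; apply: halpha.
Qed.

Lemma map_rho_splines_surj (m t : nat) (q : 'I_t -> nat) (hm : (1 < m)%N)
    (hq : forall i, (1 < q i)%N)
    (cop : forall i j, i != j -> coprime (q i) (q j))
    (hdec : m = (\prod_(i < t) q i)%N)
    (n : nat) (E : {set {set 'I_n}}) (alpha : {set 'I_n} -> {set 'Z_m})
    (halpha : forall x, x \in E -> ideal (alpha x))
    (i : 'I_t) (b : 'rV['Z_(q i)]_n) :
  b \in splines E (reduce_label (q i) alpha) ->
  exists2 f, f \in splines E alpha & b = map_mx (rho m (q i)) f.
Proof.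
(* The tuple with [b] in position [i] and the zero spline elsewhere. *)
move=> bS; pose h := dfwith (fun j => 0 : 'rV['Z_(q j)]_n) b.
have [|fS fh] := rho_star_invP hm hq cop hdec halpha (h := h); last first.
  by exists (rho_star_inv E alpha h); rewrite // fh /h dfwith_in.
move=> j; rewrite /h; case: dfwithP => // {}j _; apply: splines0 => x xE.
have qm : (q j %| m)%N by rewrite hdec (bigD1 j) //= dvdn_mulr.
by apply: ideal_rho => //; apply: halpha.
Qed.

(** * Generating sets as matrix rows, and sorted selections *)

(** The family may have repetitions: the coefficient of [g] collects those of all indices [k] with
    b_k = g. *)
Lemma generating_set_family (R : finComNzRingType) (n : nat)
    (E : {set {set 'I_n}}) (alpha : {set 'I_n} -> {set R}) (K : nat)
    (b : 'I_K -> 'rV[R]_n) :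
  (forall k, b k \in splines E alpha) ->
  (forall f, f \in splines E alpha -> exists c, f = c *m \matrix_k b k) ->
  generating_set E alpha [set b k | k : 'I_K].
Proof.
move=> bS hb; split; first by apply/subsetP=> _ /imsetP[k _ ->].
move=> f /hb[c ->]; exists (fun g => \sum_(k | b k == g) c 0 k).
rewrite mulmx_sum_row (partition_big b (mem [set b k | k : 'I_K])) /=; last first.
  by move=> k _; apply: imset_f.
apply: eq_bigr => g _; rewrite scaler_suml.
by apply: eq_bigr => k /eqP <-; rewrite rowK.
Qed.

Lemma generating_set_rows (R : finComNzRingType) (n : nat)
    (E : {set {set 'I_n}}) (alpha : {set 'I_n} -> {set R}) (S : {set 'rV[R]_n})
    (f : 'rV[R]_n) :
  generating_set E alpha S -> f \in splines E alpha ->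
  exists c, f = c *m \matrix_(j < #|S|) enum_val j.
Proof.
move=> [_ hS] /hS[c ->]; exists (\row_j c (enum_val j)).
rewrite mulmx_sum_row big_enum_val.
by apply: eq_bigr => j _; rewrite rowK mxE.
Qed.

Lemma prime_power_splines_sub (p e n : nat) (hp : prime p) (E : {set {set 'I_n}})
    (alpha : {set 'I_n} -> {set 'Z_(p ^ e)})
    (halpha : forall x, x \in E -> ideal (alpha x)) :
  prime_power_splines E alpha \subset splines E alpha.
Proof.
apply/subsetP=> _ /prime_power_splinesP[g [i [hg _ _ ->]]].
exact: component_spline_splines.
Qed.

(** Sorting yields only a weak inequality; equality is excluded because distinct elements of B_{p^e}
    have distinct leading indices. *)
Lemma sorted_leading_index_ltn (p e n : nat) (hp : prime p)
    (E : {set {set 'I_n}}) (alpha : {set 'I_n} -> {set 'Z_(p ^ e)})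
    (halpha : forall x, x \in E -> ideal (alpha x))
    (s : seq 'rV['Z_(p ^ e)]_n) (us : uniq s) (hs : s =i prime_power_splines E alpha)
    (k l : nat) (u v : 'I_n) :
  sorted (fun f g => (leading_zeros f <= leading_zeros g)%N) s ->
  (k < l)%N -> (l < size s)%N ->
  leading_index (nth 0 s k) u -> leading_index (nth 0 s l) v -> (u < v)%N.
Proof.
move=> ss kl ls ku lv; have ks := ltn_trans kl ls.
have tr : transitive (fun f g : 'rV['Z_(p ^ e)]_n =>
    (leading_zeros f <= leading_zeros g)%N) by move=> ? ? ?; apply: leq_trans.
have := sorted_ltn_nth tr 0 ss _ _ ks ls kl.
rewrite (leading_zeros_leading_index ku) (leading_zeros_leading_index lv).
rewrite leq_eqVlt => /orP[/eqP/val_inj uv|//]; rewrite uv in ku.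
have sB j : (j < size s)%N -> nth 0 s j \in prime_power_splines E alpha.
  by move=> js; rewrite -hs mem_nth.
have /eqP := prime_power_splines_leading_inj hp halpha (sB k ks) (sB l ls) ku lv.
by rewrite nth_uniq // (ltn_eqF kl).
Qed.

(** * Generation, minimality and the flow-up property over Z/m *)

Theorem theorem3p15 (m t : nat) (p e : 'I_t -> nat)
    (hm : (1 < m)%N)
    (hp : forall i, prime (p i)) (hpinj : injective p)
    (he : forall i, (0 < e i)%N)
    (hdec : m = (\prod_(i < t) p i ^ e i)%N)
    (n : nat) (E : {set {set 'I_n}}) (hG : connected_graph E)
    (alpha : {set 'I_n} -> {set 'Z_m})
    (halpha : forall x, x \in E -> ideal (alpha x))
    (s : forall i : 'I_t, seq 'rV['Z_(p i ^ e i)]_n)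
    (hs : forall i, selection_order
            (prime_power_splines E (reduce_label (p i ^ e i) alpha)) (s i)) :
  minimum_generating_set E alpha (procedure_splines E alpha s) /\
  ((forall i, sorted (fun f g => (leading_zeros f <= leading_zeros g)%N) (s i)) ->
   flow_up_minimum_generating_set E alpha (procedure_splines E alpha s)).
Proof.
pose q i := (p i ^ e i)%N.
have hq i : (1 < q i)%N by rewrite expn_gt1 ?prime_gt1.
have cop i j : i != j -> coprime (q i) (q j).
  move=> ij; rewrite /q coprime_pexpl // coprime_pexpr // prime_coprime //.
  by rewrite dvdn_prime2 // (inj_eq hpinj).
have qm i : (q i %| m)%N by rewrite hdec (bigD1 i) //= dvdn_mulr.
have hI i x : x \in E -> ideal (reduce_label (q i) alpha x).
  by move=> xE; apply: ideal_rho => //; apply: halpha.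
have us i : uniq (s i) by case: (hs i).
have sE i : s i =i prime_power_splines E (reduce_label (q i) alpha).
  by case: (hs i).
set K := (\max_(i < t) size (s i))%N.
pose b (k : nat) := rho_star_inv E alpha (fun i => nth 0 (s i) k).
have sS i k : nth 0 (s i) k \in splines E (reduce_label (q i) alpha).
  have [ki|ki] := ltnP k (size (s i)); last first.
    by rewrite nth_default //; apply/splines0/hI.
  apply: (subsetP (prime_power_splines_sub (hp i) (hI i))).
  by rewrite -sE mem_nth.
have [bS bE] : (forall k, b k \in splines E alpha) /\
    forall k i, map_mx (rho m (q i)) (b k) = nth 0 (s i) k.
  have h k := rho_star_invP hm hq cop hdec halpha (fun i => sS i k).
  by split=> k; case: (h k).
have gen : generating_set E alpha (procedure_splines E alpha s).
  apply: (@generating_set_family _ _ _ _ K (fun k => b k)) => // f fS.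
  (* Expand [f] modulo each q_i over the same K zero-padded rows, then glue the coefficients index
     by index. *)
  have /fin_all_exists[c hc] : forall i, exists c : 'rV_K,
      map_mx (rho m (q i)) f = c *m seq_rows K (s i).
    move=> i; apply: (prime_power_splines_generate (hp i) (he i) (hI i) (sE i)).
      exact: (@leq_bigmax _ (fun i => size (s i)) i).
    exact: (map_rho_splines hm (hq i) (qm i) fS).
  have /fin_all_exists[a ha] : forall k, exists a : 'Z_m,
      forall i, rho m (q i) a = c i 0 k.
    by move=> k; apply: (rho_surj hm hq cop hdec).
  exists (\row_k a k); apply/rowP=> u; apply: (rho_inj hm hq cop hdec) => i.
  have /rowP/(_ u) := hc i; rewrite mxE => ->; rewrite !mxE.
  have [r rE] := rho_rmorphism hm (hq i) (qm i).
  rewrite -rE rmorph_sum; apply: eq_bigr => k _.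
  rewrite rmorphM rE !mxE ha; congr (_ * _).
  by rewrite -bE mxE.
have min : minimum_generating_set E alpha (procedure_splines E alpha s).
  (* The set has at most K elements, and K is the largest length of an [s i]; it remains to bound
     each length by #|S|, by reducing [S] mod q_i. *)
  split=> // S genS; apply: (leq_trans (leq_imset_card _ _)).
  rewrite card_ord; apply/bigmax_leqP => i _.
  have [r rE] := rho_rmorphism hm (hq i) (qm i).
  pose M : 'M_(#|S|, n) := \matrix_j enum_val j.
  apply: (prime_power_splines_min (hp i) (he i) (hI i) (us i) (sE i)
           (S := map_mx (rho m (q i)) M)) => [j|c cB].
    rewrite -map_row rowK; apply: (map_rho_splines hm (hq i) (qm i)).
    by case: genS => /subsetP sub _; apply/sub/enum_valP.
  have cS := subsetP (prime_power_splines_sub (hp i) (hI i)) _ cB.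
  have [f fS ->] := map_rho_splines_surj hm hq cop hdec halpha cS.
  have [a ->] := generating_set_rows genS fS.
  by exists (map_mx r a); rewrite -rE map_mxM.
split=> // ss; split=> //.
have [n0 _ _] := hG.
(* The default vertex is returned only for the zero row, which is not among the b_k with k < K. *)
pose lead (f : 'rV['Z_m]_n) : 'I_n := odflt (Ordinal n0) [pick u | leading_index f u].
have leadP (f : 'rV['Z_m]_n) : f != 0 -> leading_index f (lead f).
  move=> /ex_leading_index[u fu]; rewrite /lead.
  by case: pickP => [//|/(_ u)]; rewrite fu.
have lead_s i k : (k < size (s i))%N -> exists u, leading_index (nth 0 (s i) k) u.
  move=> ki; have [|u [iu _]] := @prime_power_splines_entries _ _ _ (hp i) E
    (reduce_label (q i) alpha) (nth 0 (s i) k); first by rewrite -sE mem_nth.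
  by exists u.
have b_neq0 i k u : nth 0 (s i) k 0 u != 0 -> b k 0 u != 0.
  rewrite -bE mxE; apply: contraNneq => ->.
  by have [r rE] := rho_rmorphism hm (hq i) (qm i); rewrite -rE rmorph0.
have b0 k : (k < K)%N -> b k != 0.
  move=> kK; have [i ki] : exists i, (k < size (s i))%N.
    apply/existsP; apply: contraTT kK => /existsPn h.
    by rewrite -leqNgt; apply/bigmax_leqP => i _; rewrite leqNgt.
  have [u /leading_indexP[/b_neq0 bu _]] := lead_s i k ki.
  by apply: contraNneq bu => ->; rewrite mxE.
have lead_neq k l : (k < l)%N -> (l < K)%N -> lead (b k) != lead (b l).
  move=> kl lK; have kK := ltn_trans kl lK.
  have lk := leadP _ (b0 k kK).
  have [bl _] := leading_indexP _ _ (leadP _ (b0 l lK)).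
  (* Fix a prime that sees the leading entry of b_l. With u and v the leading indices of entries k
     and l of [s i], lead(b_k) <= u < v <= lead(b_l). *)
  have [i il] : exists i, nth 0 (s i) l 0 (lead (b l)) != 0.
    apply/existsP; apply: contraNT bl => /existsPn h; apply/eqP.
    apply: (rho_inj hm hq cop hdec) => i; move/(_ i): h; rewrite -bE mxE negbK.
    by have [r rE] := rho_rmorphism hm (hq i) (qm i); rewrite -rE rmorph0 => /eqP.
  have li : (l < size (s i))%N.
    rewrite ltnNge; apply: contraNN il => li.
    by rewrite nth_default // mxE.
  have [u uk] := lead_s i k (ltn_trans kl li); have [v vl] := lead_s i l li.
  have uv := sorted_leading_index_ltn (hp i) (hI i) (us i) (sE i) (ss i) kl li uk vl.
  have [/b_neq0 bu _] := leading_indexP _ _ uk.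
  rewrite -val_eqE neq_ltn; apply/orP; left.
  apply: leq_ltn_trans (leading_index_le lk bu) _.
  exact: leq_trans uv (leading_index_le vl il).
exists lead; split=> [_ _ /imsetP[k _ ->] /imsetP[l _ ->] /eqP kl|_ /imsetP[k _ ->]].
  congr (b _); apply/eqP; apply: contraTT kl; rewrite neq_ltn => /orP[kl|lk].
    exact: lead_neq.
  by rewrite eq_sym; apply: lead_neq.
have [fk f0] := leading_indexP _ _ (leadP _ (b0 k (ltn_ord k))).
by split=> //; split=> //; apply: bS.
Qed.
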